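(* Let $E$ be a finite set, $f:2^E\to\mathbb{R}$ a polymatroid function with associated polymatroid $P_f$ and base polytope $B_f$, and let $s\in\mathbb{R}^E_{>0}$ and $m\in\mathbb{R}^E_{\ge 0}$. Let $$\alpha:=\min\{h>0: s\in hP_f\},\qquad A_h:=\{z\in\mathbb{R}^E_{\ge 0}: s+z\in hB_f\}\quad (h>0),$$ where the set of $h$ defining $\alpha$ is assumed to be nonempty. For every $h\ge\alpha$ let $z^*_h$ be an optimal solution of the problem $\min_{z\in A_h} m\cdot z$. Then $$m\cdot z^*_h\ \ge\ m\cdot z^*_\alpha\qquad\text{for all } h\ge\alpha.$$ In other words, the polymatroid reinforcement problem of minimizing $m\cdot z$ over all $z\in\mathbb{R}^E_{\ge 0}$ such that $s+z\in hB_f$ for some $h>0$ is equivalent to (has the same minimum value as) the problem $\min_{z\in A_\alpha} m\cdot z$.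
   Context: For $x\in\mathbb{R}^E$ and $A\subseteq E$ write $x(A)=\sum_{e\in A}x(e)$, and $m\cdot z=\sum_{e\in E} m(e)z(e)$. A polymatroid function is a function $f:2^E\to\mathbb{R}$ with $f(\emptyset)=0$, $f(A)\le f(B)$ whenever $A\subseteq B\subseteq E$, and $f(A\cap B)+f(A\cup B)\le f(A)+f(B)$ for all $A,B\subseteq E$. Its associated polymatroid and base polytope are $$P_f=\{x\in\mathbb{R}^E: x\ge 0,\ x(A)\le f(A)\ \forall A\subseteq E\},\qquad B_f=\{x\in P_f: x(E)=f(E)\}.$$ For $h>0$, $hP_f=\{hx:x\in P_f\}$ and $hB_f=\{hx:x\in B_f\}$. *)

(* Defs.v *)
From HB Require Import structures.
From mathcomp Require Import all_boot all_order all_algebra.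
From mathcomp Require Import classical_sets reals.

Set Implicit Arguments.
Unset Strict Implicit.
Unset Printing Implicit Defensive.

Import Order.TTheory GRing.Theory Num.Theory.

Local Open Scope classical_set_scope.
Local Open Scope ring_scope.

Section Polymatroids.
Variables (R : realType) (E : finType).

(* R^E is {ffun E -> R}; R is not a module over itself (only R^o is), hence the
   explicit pointwise product in dilate below. *)
Implicit Types (f : {set E} -> R) (x y z s m : {ffun E -> R}) (A B : {set E}).

Definition vsum x A : R := \sum_(e in A) x e.

Definition dotp m z : R := \sum_(e : E) m e * z e.

Definition polymatroid_function f : Prop :=
  [/\ f finset.set0 = 0,
      forall A B, A \subset B -> f A <= f B
    & forall A B, f (A :&: B) + f (A :|: B) <= f A + f B].

Definition polymatroid f : set {ffun E -> R} :=
  [set x : {ffun E -> R} |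
    (forall e, 0 <= x e) /\ (forall A, vsum x A <= f A)].

Definition base_polytope f : set {ffun E -> R} :=
  [set x : {ffun E -> R} | polymatroid f x /\ vsum x [set: E]%SET = f [set: E]%SET].

Definition dilate (h : R) (P : set {ffun E -> R}) : set {ffun E -> R} :=
  [set [ffun e => h * x e] | x in P].

Definition scales f s : set R :=
  [set h : R | 0 < h /\ dilate h (polymatroid f) s].

Definition reinforcements f s (h : R) : set {ffun E -> R} :=
  [set z : {ffun E -> R} |
    (forall e, 0 <= z e) /\ dilate h (base_polytope f) (s + z)].

Definition all_reinforcements f s : set {ffun E -> R} :=
  [set z : {ffun E -> R} |
    (forall e, 0 <= z e) /\ exists2 h : R, 0 < h & dilate h (base_polytope f) (s + z)].

Definition is_optimal m (Z : set {ffun E -> R}) z : Prop :=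
  Z z /\ forall y, Z y -> dotp m z <= dotp m y.

End Polymatroids.

Definition is_min (R : realType) (S : set R) (a : R) : Prop :=
  S a /\ forall b, S b -> a <= b.

(* Main.v *)
Require Import Defs.
From mathcomp Require Import all_boot all_order all_algebra.
From mathcomp Require Import classical_sets reals.
From mathcomp Require Import lra.

(** Write g = h f, so that hP_f and hB_f are the polymatroid and the base
    polytope of g, and pass from a reinforcement z to w = s + z >= s.

    Everything rests on the greedy algorithm: starting from s in P_g, raise the
    coordinates one after the other, each as far as P_g and a cap w allow.  When
    the algorithm stops, a coordinate below its cap lies in a tight set, that is
    a set A with x(A) = g(A).  By submodularity tight sets are closed under
    union, so one tight set T contains all coordinates below their cap
    ([greedy_saturated]).

    Monotonicity in h.  Let w >= s lie in hB_f, let alpha <= h, and run the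
    greedy algorithm for alpha f with cap w.  The result u lies in alpha P_f,
    s <= u <= w, and for its tight set T
      u(E) = alpha f(T) + w(E) - w(T) >= alpha f(T) + h (f(E) - f(T))
           >= alpha f(E),
    since w(E) = h f(E), w(T) <= h f(T) and f(T) <= f(E).  So u is in alpha B_f
    ([exists_smaller_base]), and u - s is a reinforcement at scale alpha that
    costs no more than w - s because m >= 0.  This gives the inequality, and the
    equality of the two minimum values follows since any h > 0 admitting a
    reinforcement satisfies s in hP_f, hence alpha <= h.

    Existence of optimal solutions.  Running the greedy algorithm by increasing
    cost, with caps that are never reached, makes E itself tight, so the result
    is a base.  The tight sets at the intermediate stages show that it has the
    largest possible total on each initial segment of the order, which makes it
    cheapest ([greedy_sorted_le]).

    The least scale itself is the maximum of s(A)/f(A) over nonempty A. *)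

Set Implicit Arguments.
Unset Strict Implicit.
Unset Printing Implicit Defensive.

Import Order.TTheory GRing.Theory Num.Theory.

Local Open Scope classical_set_scope.
Local Open Scope ring_scope.

(** * Sums and costs *)

Section Polymatroids.
Variables (R : realType) (E : finType).
Implicit Types (f g : {set E} -> R) (s u w x y z m : {ffun E -> R}).
Implicit Types (A B T : {set E}) (l : seq E) (h : R).

Lemma ler_vsum x y A : {in A, forall e, x e <= y e} -> vsum x A <= vsum y A.
Proof. exact: ler_sum. Qed.

Lemma vsumT x : vsum x [set: E] = \sum_e x e.
Proof. by apply: eq_bigl => e; rewrite inE. Qed.

Lemma vsum_setID x A B : vsum x A = vsum x (A :&: B) + vsum x (A :\: B).
Proof. by rewrite /vsum (big_setID B). Qed.

Lemma dotpB m x y : dotp m (x - y) = dotp m x - dotp m y.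
Proof.
by rewrite /dotp -sumrB; apply: eq_bigr => e _; rewrite !ffunE mulrBr.
Qed.

Lemma dotpD m x y : dotp m (x + y) = dotp m x + dotp m y.
Proof.
by rewrite /dotp -big_split; apply: eq_bigr => e _; rewrite !ffunE mulrDr.
Qed.

Lemma ler_dotp m x y : (forall e, 0 <= m e) -> (forall e, x e <= y e) ->
  dotp m x <= dotp m y.
Proof. by move=> m0 xy; apply: ler_sum => e _; apply: ler_wpM2l. Qed.

(** * Dilations *)

Lemma polymatroid_function_dilate f h : 0 <= h -> polymatroid_function f ->
  polymatroid_function (fun A => h * f A).
Proof.
move=> h0 [f0 fS fU]; split=> [|A B AB|A B]; first by rewrite f0 mulr0.
- by rewrite ler_wpM2l // fS.
- by rewrite -!mulrDr ler_wpM2l.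
Qed.

Lemma vsum_dilate h x A : vsum [ffun e => h * x e] A = h * vsum x A.
Proof. by rewrite /vsum mulr_sumr; apply: eq_bigr => e _; rewrite ffunE. Qed.

Lemma dilate_polymatroid f h x : 0 < h ->
  dilate h (polymatroid f) x <-> polymatroid (fun A => h * f A) x.
Proof.
move=> h0; split=> [[y [y0 yf] <-]|[x0 xf]].
  split=> [e|A]; first by rewrite ffunE mulr_ge0 // ltW.
  by rewrite vsum_dilate ler_pM2l.
exists [ffun e => h^-1 * x e].
  split=> [e|A]; first by rewrite ffunE mulr_ge0 // invr_ge0 ltW.
  by rewrite vsum_dilate ler_pdivrMl.
by apply/ffunP => e; rewrite !ffunE mulrA divff ?mul1r // gt_eqF.
Qed.

Lemma dilate_base_polytope f h x : 0 < h ->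
  dilate h (base_polytope f) x <-> base_polytope (fun A => h * f A) x.
Proof.
move=> h0; split=> [[y [yP yE] <-]|[xP xE]].
  split; last by rewrite vsum_dilate yE.
  by apply/dilate_polymatroid => //; exists y.
have [y yP yx] := (dilate_polymatroid f x h0).2 xP.
exists y => //; split=> //.
by move: xE; rewrite -yx vsum_dilate => /(mulfI (lt0r_neq0 h0)).
Qed.

(** * The least scale *)

(** Nonnegativity of s makes membership in hP_f a finite system of linear
    inequalities in h. *)
Lemma scalesP f s h : (forall e, 0 < s e) ->
  scales f s h <-> 0 < h /\ forall A, vsum s A <= h * f A.
Proof.
move=> s0; split=> -[h0 sh]; split=> //.
  by case: ((dilate_polymatroid f s h0).1 sh).
by apply/dilate_polymatroid => //; split=> // e; rewrite ltW.
Qed.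

Lemma vsum_gt0 s A : (forall e, 0 < s e) -> A != finset.set0 -> 0 < vsum s A.
Proof.
move=> s0 /set0Pn[e eA]; rewrite /vsum (bigD1 e) //= ltr_pwDl //.
by apply: sumr_ge0 => a _; rewrite ltW.
Qed.

(** Since s > 0 and some scale exists, f is positive on nonempty sets, and the
    inequalities s(A) <= h f(A) say that h is at least the largest of the ratios
    s(A)/f(A). *)
Lemma exists_min_scale f s : polymatroid_function f ->
  (forall e, 0 < s e) -> (0 < #|E|)%N ->
  (exists h, scales f s h) -> exists alpha, is_min (scales f s) alpha.
Proof.
move=> [f0 _ _] s0 E0 [h0 /scalesP-/(_ s0)[h0_gt0 sh0]].
have f_gt0 A : A != finset.set0 -> 0 < f A.
  move=> /(vsum_gt0 s0) sA; rewrite -(pmulr_rgt0 _ h0_gt0).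
  exact: lt_le_trans (sh0 A).
pose alpha := \big[Order.max/0]_(A : {set E} | A != finset.set0) (vsum s A / f A).
have ratio_le A : A != finset.set0 -> vsum s A / f A <= alpha.
  by move=> An0; apply: le_bigmax_cond.
have ET : [set: E]%SET != finset.set0 by rewrite -card_gt0 cardsT.
exists alpha; split=> [|b /scalesP-/(_ s0)[b0 sb]].
  apply/scalesP => //; split=> [|A].
    by apply: lt_le_trans (ratio_le _ ET); rewrite divr_gt0 ?f_gt0 ?vsum_gt0.
  have [->|An0] := eqVneq A finset.set0; first by rewrite f0 mulr0 /vsum big_set0.
  by rewrite -ler_pdivrMr ?f_gt0 ?ratio_le.
apply: bigmax_le => [|A An0]; first exact: ltW.
by rewrite ler_pdivrMr ?f_gt0.
Qed.

(** * Tight sets *)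

Definition tight g x A := vsum x A = g A.

(** x(A) + x(B) = x(A /\ B) + x(A \/ B) is at most g(A /\ B) + g(A \/ B), which
    by submodularity is at most g(A) + g(B); tightness of A and B turns this
    chain into equalities. *)
Lemma tightU g x A B : polymatroid_function g -> polymatroid g x ->
  tight g x A -> tight g x B -> tight g x (A :|: B).
Proof.
move=> [_ _ gU] [_ xg] xA xB; apply/eqP; rewrite eq_le xg /=.
have xAB : vsum x (A :|: B) + vsum x (A :&: B) = vsum x A + vsum x B.
  rewrite (vsum_setID x (A :|: B) A) (vsum_setID x B A) finset.setUK
    finset.setDUl finset.setDv finset.set0U finset.setIC.
  lra.
have := gU A B; have := xg (A :&: B); rewrite -xA -xB; lra.
Qed.

Lemma tight_le g x y A : (forall e, x e <= y e) -> polymatroid g y ->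
  tight g x A -> tight g y A.
Proof.
by move=> xy [_ yg] xA; apply/eqP; rewrite eq_le yg -xA ler_vsum.
Qed.

(** T is a certificate that no coordinate of l can be raised: on T the bound g
    blocks, and off T the cap w does. *)
Definition saturated g w x l T :=
  tight g x T /\ {in l, forall e, e \notin T -> x e = w e}.

(** On T the total of x cannot be exceeded; on l outside T, x is at its cap; and
    on T outside l, x has kept its least value s, so that an excess of y over x
    on the part of l inside T would make y(T) larger than x(T) = g(T). *)
Lemma saturated_max g w s x y l T : saturated g w x l T ->
  {in [predC l], x =1 s} -> polymatroid g y ->
  (forall e, s e <= y e) -> (forall e, y e <= w e) ->
  vsum y [set e in l]%SET <= vsum x [set e in l]%SET.
Proof.
move=> [xT xw] xs [_ yg] sy yw; set L := [set e in l]%SET.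
have yT : vsum y T <= vsum x T by rewrite xT.
have LT : vsum y (L :\: T) <= vsum x (L :\: T).
  by apply: ler_vsum => e; rewrite !inE => /andP[eT el]; rewrite xw.
have TL : vsum x (T :\: L) <= vsum y (T :\: L).
  by apply: ler_vsum => e; rewrite !inE => /andP[el _]; rewrite xs // inE.
move: yT LT TL; rewrite !(vsum_setID _ L T) !(vsum_setID _ T L).
rewrite (finset.setIC T L); lra.
Qed.

(** * The greedy algorithm *)

(** The cap slack w e - x e is the default value of the minimum, so that the room
    is the least of it and of the slacks of all sets containing e. *)
Definition room g w x e :=
  \big[Order.min/w e - x e]_(A : {set E} | e \in A) (g A - vsum x A).

Definition raise g w x e : {ffun E -> R} :=
  [ffun a => x a + (if a == e then room g w x e else 0)].

Definition greedy g w s l := foldl (raise g w) s l.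

Lemma vsum_raise g w x e A :
  vsum (raise g w x e) A = vsum x A + (if e \in A then room g w x e else 0).
Proof.
rewrite /vsum (eq_bigr _ (fun a _ => ffunE _ a)) big_split /=; congr (_ + _).
rewrite -big_mkcondr /=; case: ifP => eA.
  rewrite (big_pred1 e) // => a /=.
  by rewrite andbC; case: eqVneq => // ->.
by rewrite big_pred0 // => a; rewrite andbC; case: eqVneq => // ->.
Qed.

Section Raise.
Variables (g : {set E} -> R) (w x : {ffun E -> R}).
Hypotheses (xP : polymatroid g x) (xw : forall e, x e <= w e).

Lemma room_ge0 e : 0 <= room g w x e.
Proof.
apply/bigmin_geP; split=> [|A _]; rewrite subr_ge0 //; by case: xP.
Qed.

Lemma raise_ge e a : x a <= raise g w x e a.
Proof. by rewrite ffunE lerDl; case: ifP; rewrite ?room_ge0. Qed.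

Lemma raise_le e a : raise g w x e a <= w a.
Proof.
rewrite ffunE; case: eqVneq => [->|_]; last by rewrite addr0.
by rewrite -lerBrDl; apply: bigmin_le_id.
Qed.

Lemma raise_polymatroid e : polymatroid g (raise g w x e).
Proof.
have [x0 xg] := xP; split=> [a|A]; first exact: le_trans (raise_ge e a).
rewrite vsum_raise; case: ifP => eA; last by rewrite addr0.
by rewrite -lerBrDl; apply: bigmin_le_cond.
Qed.

Lemma raise_saturates e : raise g w x e e = w e \/
  exists2 A : {set E}, e \in A & tight g (raise g w x e) A.
Proof.
have : room g w x e = w e - x e \/
    exists2 A : {set E}, e \in A & room g w x e = g A - vsum x A.
  rewrite /room; elim/big_ind: _ => [|r1 r2 P1 P2|A eA]; first by left.
  - by rewrite minElt; case: ifP.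
  - by right; exists A.
case=> [re|[A eA re]]; [left|right; exists A => //].
  by rewrite ffunE eqxx re addrC subrK.
by rewrite /tight vsum_raise eA re addrC subrK.
Qed.

End Raise.

Section Greedy.
Variables (g : {set E} -> R) (w s : {ffun E -> R}).
Hypotheses (gP : polymatroid_function g).
Hypotheses (sP : polymatroid g s) (sw : forall e, s e <= w e).

Lemma greedy_rcons l e :
  greedy g w s (rcons l e) = raise g w (greedy g w s l) e.
Proof. exact: foldl_rcons. Qed.

Lemma greedy_feasible l :
  [/\ polymatroid g (greedy g w s l), forall e, s e <= greedy g w s l e
    & forall e, greedy g w s l e <= w e].
Proof.
elim/last_ind: l => [//|l e [uP su uw]]; rewrite greedy_rcons.
split=> [|a|a]; first exact: raise_polymatroid.
- exact: le_trans (su a) (raise_ge _ _ _ _).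
- exact: raise_le.
Qed.

Lemma greedy_notin l : {in [predC l], greedy g w s l =1 s}.
Proof.
elim/last_ind: l => [//|l e IH] a; rewrite !inE mem_rcons inE negb_or.
by case/andP=> /negbTE ae al; rewrite greedy_rcons ffunE ae addr0 IH.
Qed.

(** Raising further coordinates keeps tight sets tight and leaves capped
    coordinates at their cap.  The coordinate just raised either reaches its cap
    or lies in a new tight set, which is then merged into the previous one. *)
Lemma greedy_saturated l : exists T, saturated g w (greedy g w s l) l T.
Proof.
elim/last_ind: l => [|l e [T [uT uw]]].
  by exists finset.set0; split=> //; rewrite /tight /vsum big_set0; case: gP.
have [uP _ u_le] := greedy_feasible l.
have [vP _ v_le] := greedy_feasible (rcons l e).
have vT : tight g (greedy g w s (rcons l e)) T.
  by apply: tight_le uT => // a; rewrite greedy_rcons raise_ge.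
have old a : a \in l -> a \notin T -> greedy g w s (rcons l e) a = w a.
  move=> al aT; apply/eqP; rewrite eq_le v_le -(uw a al aT).
  by rewrite greedy_rcons raise_ge.
case: (raise_saturates g w (greedy g w s l) e) => [|[A eA]];
  rewrite -greedy_rcons => ve.
  exists T; split=> // a; rewrite mem_rcons inE => /predU1P[->//|].
  exact: old.
exists (T :|: A); split=> [|a]; first exact: tightU vT ve.
rewrite mem_rcons !inE negb_or => /predU1P[->|al /andP[aT _]]; last exact: old.
by rewrite eA andbF.
Qed.

(** When y and the greedy vector u have the same total on l, the left side is 0
    and u costs no more than y.  The free bound c turns Abel summation into an
    induction on l.  The totals D = (y - u)(l) over initial segments are
    nonpositive by [saturated_max]; so in c * D the factor c may be lowered to
    the cost of the last element e, which still bounds the costs of the earlier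
    ones, and the induction hypothesis applies with that cost as c. *)
Lemma greedy_sorted_le m l c y : uniq l ->
  sorted (relpre m <=%R) l -> {in l, forall e, m e <= c} ->
  polymatroid g y -> (forall e, s e <= y e) -> (forall e, y e <= w e) ->
  c * (\sum_(e <- l) (y e - greedy g w s l e))
    <= \sum_(e <- l) m e * (y e - greedy g w s l e).
Proof.
move=> + + + yP sy yw; elim/last_ind: l c => [|l e IH] c.
  by rewrite !big_nil mulr0.
move=> ul sl lc.
have D_le0 : \sum_(a <- rcons l e) (y a - greedy g w s (rcons l e) a) <= 0.
  have [T uT] := greedy_saturated (rcons l e).
  have := saturated_max uT (greedy_notin (l := _)) yP sy yw.
  by rewrite sumrB subr_le0 !(big_uniq _ ul) /vsum !big_set.
have ec : m e <= c by apply: lc; rewrite mem_rcons mem_head.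
apply: le_trans (_ : m e * (\sum_(a <- rcons l e)
    (y a - greedy g w s (rcons l e) a)) <= _).
  by rewrite ler_wnM2r.
(* Raising e does not change the vector on l, so the terms over l are those of
   the induction hypothesis. *)
move: ul; rewrite rcons_uniq => /andP[el ul].
have leT : transitive (relpre m <=%R) by move=> a b d /=; apply: le_trans.
move: sl; rewrite !sorted_pairwise // pairwise_rcons => /andP[/allP le_e].
rewrite -sorted_pairwise // => sl.
have agree a : a \in l -> greedy g w s (rcons l e) a = greedy g w s l a.
  move=> al; rewrite greedy_rcons ffunE; case: eqVneq => [ae|_]; last by rewrite addr0.
  by rewrite -ae al in el.
rewrite -cats1 !big_cat !big_seq1 /= cats1 mulrDr lerD2r.
rewrite (eq_big_seq (fun a => y a - greedy g w s l a)); last first.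
  by move=> a al; rewrite agree.
rewrite [leRHS](eq_big_seq (fun a => m a * (y a - greedy g w s l a))); last first.
  by move=> a al; rewrite agree.
by apply: IH.
Qed.

End Greedy.

(** * Reinforcements *)

(** The greedy vector works, provided the coordinates are raised in order of
    increasing cost. *)
Lemma exists_cheapest_base g s m : polymatroid_function g -> polymatroid g s ->
  (forall e, 0 <= m e) ->
  exists u, [/\ base_polytope g u, forall e, s e <= u e
    & forall y, base_polytope g y -> (forall e, s e <= y e) ->
        dotp m u <= dotp m y].
Proof.
move=> gP sP m0.
(* Every x in P_g has x e <= g {e}, so these caps are never reached and the
   tight set of the greedy vector must be all of E. *)
pose w : {ffun E -> R} := [ffun e => g [set e]%SET + 1].
have lt_w x : polymatroid g x -> forall e, x e < w e.
  move=> [_ xg] e; rewrite ffunE ltr_pwDr //.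
  by have := xg [set e]%SET; rewrite /vsum big_set1.
have le_w x : polymatroid g x -> forall e, x e <= w e by move=> xP e; rewrite ltW ?lt_w.
pose l := sort (relpre m <=%R) (enum E).
have pl : perm_eq l (enum E) by rewrite perm_sort.
have ul : uniq l by rewrite sort_uniq enum_uniq.
have sl : sorted (relpre m <=%R) l by apply: sort_sorted => a b /=; apply: le_total.
have sum_l (F : E -> R) : \sum_(e <- l) F e = \sum_e F e.
  by rewrite (perm_big _ pl) big_enum.
have [uP su _] := greedy_feasible sP (le_w s sP) l.
have [T [uT uwT]] := greedy_saturated gP sP (le_w s sP) l.
have optimal := greedy_sorted_le gP sP (le_w s sP) ul sl.
set u := greedy g w s l in uP su uT uwT optimal.
have uE : vsum u [set: E]%SET = g [set: E]%SET.
  suff <- : T = [set: E]%SET by [].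
  apply/setP => e; rewrite inE; apply: contraT => eT.
  have := lt_w u uP e; rewrite uwT ?ltxx //.
  by rewrite (perm_mem pl) mem_enum.
exists u; split=> // y [yP yE] sy.
(* Any common bound of the costs will do, as it multiplies the difference of the
   totals of two bases, which is zero. *)
have m_le e : e \in l -> m e <= \sum_a m a.
  by move=> _; rewrite (bigD1 e) //= lerDl sumr_ge0.
have := optimal _ _ m_le yP sy (le_w y yP).
rewrite !sum_l sumrB.
have -> : \sum_e y e - \sum_e u e = 0.
  apply/eqP; rewrite subr_eq0; apply/eqP.
  by move: yE; rewrite -uE !vsumT.
rewrite mulr0; under eq_bigr do rewrite mulrBr.
by rewrite sumrB subr_ge0.
Qed.

(** Scaling f down can be followed by lowering a base: run the greedy algorithm
    for alpha f with cap w, and compare totals on its tight set and outside. *)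
Lemma exists_smaller_base f s w alpha h : polymatroid_function f ->
  alpha <= h -> 0 < alpha ->
  polymatroid (fun A => alpha * f A) s -> (forall e, s e <= w e) ->
  base_polytope (fun A => h * f A) w ->
  exists u, [/\ base_polytope (fun A => alpha * f A) u,
    forall e, s e <= u e & forall e, u e <= w e].
Proof.
move=> fP alpha_h alpha0 sP sw [[_ wf] wE].
pose g A := alpha * f A.
have gP : polymatroid_function g.
  by apply: polymatroid_function_dilate => //; apply: ltW.
have [uP su uw] := greedy_feasible sP sw (enum E).
have [T [uT uwT]] := greedy_saturated gP sP sw (enum E).
exists (greedy g w s (enum E)); split=> //; split=> //.
apply/eqP; rewrite eq_le; have [_ ->] := uP; rewrite /=.
have eqT : vsum (greedy g w s (enum E)) (~: T) = vsum w (~: T).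
  by apply: eq_bigr => e; rewrite inE => eT; rewrite uwT ?mem_enum.
have split_T x : vsum x [set: E] = vsum x T + vsum x (~: T).
  by rewrite (vsum_setID x _ T) finset.setTI finset.setTD.
have fT : f T <= f [set: E]%SET by case: fP => _ fS _; apply: fS; apply: finset.subsetT.
(* This is where alpha <= h enters: h (f(E) - f(T)) >= alpha (f(E) - f(T)). *)
have := ler_wpM2r (_ : 0 <= f [set: E]%SET - f T) alpha_h.
rewrite subr_ge0 fT => /(_ isT).
have := wf T; move: wE; rewrite !split_T uT eqT /g; lra.
Qed.

Lemma reinforcementsP f s z h : 0 < h ->
  reinforcements f s h z <->
  (forall e, 0 <= z e) /\ base_polytope (fun A => h * f A) (s + z).
Proof.
by move=> h0; split=> -[z0 /(dilate_base_polytope _ _ h0)].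
Qed.

Lemma exists_optimal_reinforcement f s m h : polymatroid_function f ->
  (forall e, 0 <= m e) -> 0 < h -> polymatroid (fun A => h * f A) s ->
  exists z, is_optimal m (reinforcements f s h) z.
Proof.
move=> fP m0 h0 sP.
have gP := polymatroid_function_dilate (ltW h0) fP.
have [u [uB su u_opt]] := exists_cheapest_base gP sP m0.
exists (u - s); split=> [|y /reinforcementsP-/(_ h0)[y0 yB]].
  apply/reinforcementsP => //; split=> [e|]; first by rewrite !ffunE subr_ge0.
  by rewrite addrC subrK.
rewrite dotpB lerBlDl -dotpD u_opt // => e.
by rewrite ffunE lerDl.
Qed.

Lemma exists_cheaper_reinforcement f s m z alpha h : polymatroid_function f ->
  (forall e, 0 <= m e) -> 0 < alpha -> alpha <= h ->
  polymatroid (fun A => alpha * f A) s -> reinforcements f s h z ->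
  exists2 y, reinforcements f s alpha y & dotp m y <= dotp m z.
Proof.
move=> fP m0 alpha0 alpha_h sP.
move=> /(reinforcementsP _ _ _ (lt_le_trans alpha0 alpha_h))[z0 zB].
have sz e : s e <= (s + z) e by rewrite ffunE lerDl.
have [u [uB su uz]] := exists_smaller_base fP alpha_h alpha0 sP sz zB.
exists (u - s).
  apply/reinforcementsP => //; split=> [e|]; first by rewrite !ffunE subr_ge0.
  by rewrite addrC subrK.
by rewrite dotpB lerBlDl -dotpD ler_dotp.
Qed.

Lemma scales_of_reinforcement f s z h : (forall e, 0 < s e) -> 0 < h ->
  reinforcements f s h z -> scales f s h.
Proof.
move=> s0 h0 /reinforcementsP-/(_ h0)[z0 [[_ szf] _]].
apply/scalesP => //; split=> // A; apply: le_trans (szf A).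
by apply: ler_vsum => e _; rewrite ffunE lerDl.
Qed.

End Polymatroids.

Theorem theorem3p9 (R : realType) (E : finType) (f : {set E} -> R)
    (s m : {ffun E -> R})
    (f_polymatroid : polymatroid_function f)
    (s_gt0 : forall e : E, 0 < s e)
    (m_ge0 : forall e : E, 0 <= m e)
    (scales_nonempty : exists h : R, scales f s h) :
  ((0 < #|E|)%N -> exists alpha : R, is_min (scales f s) alpha) /\
  (forall alpha : R, is_min (scales f s) alpha ->
    [/\ forall h : R, alpha <= h ->
          exists z : {ffun E -> R}, is_optimal m (reinforcements f s h) z,
        forall zstar : R -> {ffun E -> R},
          (forall h : R, alpha <= h ->
             is_optimal m (reinforcements f s h) (zstar h)) ->
          forall h : R, alpha <= h ->
            dotp m (zstar h) >= dotp m (zstar alpha)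
      & exists v : R,
          is_min [set dotp m z | z in all_reinforcements f s] v /\
          is_min [set dotp m z | z in reinforcements f s alpha] v]).
Proof.
split=> [E0|alpha [alpha_scale alpha_min]]; first exact: exists_min_scale.
have alpha0 : 0 < alpha by case: alpha_scale.
have sP h : alpha <= h -> polymatroid (fun A => h * f A) s.
  move=> alpha_h; have h0 := lt_le_trans alpha0 alpha_h.
  have /scalesP-/(_ s_gt0)[_ sf] := alpha_scale.
  split=> [e|A]; first exact: ltW.
  apply: le_trans (sf A) _; apply: ler_wpM2r => //.
  rewrite -(pmulr_rge0 _ alpha0); apply: le_trans (sf A).
  by apply: sumr_ge0 => e _; apply: ltW.
have cheaper h z : alpha <= h -> reinforcements f s h z ->
    exists2 y, reinforcements f s alpha y & dotp m y <= dotp m z.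
  by move=> alpha_h; apply: exists_cheaper_reinforcement => //; apply: sP.
have optimal h : alpha <= h -> exists z, is_optimal m (reinforcements f s h) z.
  move=> alpha_h; apply: exists_optimal_reinforcement => //; last exact: sP.
  exact: lt_le_trans alpha_h.
split=> // [zstar zstarP h alpha_h|].
  have [/(cheaper _ _ alpha_h)[y yA yz] _] := zstarP h alpha_h.
  have [_ zalpha_min] := zstarP alpha (lexx _).
  exact: le_trans (zalpha_min y yA) yz.
have [z [zA z_min]] := optimal alpha (lexx _).
exists (dotp m z); split; split.
- by exists z => //; case: zA => z0 zB; split=> //; exists alpha.
- move=> _ [y [y0 [h h0 yB]] <-].
  have yR : reinforcements f s h y by split.
  have alpha_h := alpha_min h (scales_of_reinforcement s_gt0 h0 yR).
  have [x xA xy] := cheaper h y alpha_h yR.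
  exact: le_trans (z_min x xA) xy.
- by exists z.
- by move=> _ [y yA <-]; apply: z_min.
Qed.
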